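(* Let $G$ and $H$ be finitely generated groups acting compatibly on each other. If the derivative $[G,H]$ is finitely presented, then the non-abelian tensor product $G\otimes H$ is finitely presented.
   Context: Actions are on the right, and each group acts on itself by conjugation, $x^y=y^{-1}xy$. Groups $G$ and $H$, each acting on the other, act compatibly if for all $g,g_1\in G$, $h,h_1\in H$: $g^{(h^{g_1})} = ((g^{g_1^{-1}})^h)^{g_1}$ and $h^{(g^{h_1})} = ((h^{h_1^{-1}})^g)^{h_1}$. The non-abelian tensor product $G\otimes H$ is the group generated by symbols $g\otimes h$ ($g\in G$, $h\in H$) subject to the relations $gg_1\otimes h = (g^{g_1}\otimes h^{g_1})(g_1\otimes h)$ and $g\otimes hh_1 = (g\otimes h_1)(g^{h_1}\otimes h^{h_1})$ for all $g,g_1\in G$, $h,h_1\in H$. The derivative of $G$ under the action of $H$ is the subgroup $[G,H]=\langle g^{-1}g^h \mid g\in G,\ h\in H\rangle$ of $G$. *)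

(* Defs.v *)
From HB Require Import structures.
From mathcomp Require Import all_boot boolp classical_sets.

Set Implicit Arguments.
Unset Strict Implicit.
Unset Printing Implicit Defensive.

Local Open Scope quotient_scope.
Local Open Scope classical_set_scope.
Local Open Scope group_scope.

(* A [groupType] carries a choice structure; under the classical axioms of *)
(* [boolp] every type has one, so [groupType] covers all groups. *)

Definition subgroup_set (G : groupType) (K : set G) : Prop :=
  [/\ K 1, forall x y, K x -> K y -> K (x * y) & forall x, K x -> K x^-1].

Definition gen_set (G : groupType) (S : set G) : set G :=
  \bigcap_(K in [set K | subgroup_set K /\ S `<=` K]) K.

Record gen_group (G : groupType) (S : set G) : Type := GenGroup {
  gen_val : G;
  _ : gen_val \in gen_set S
}.

Section GenGroup.
Variables (G : groupType) (S : set G).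

Lemma gen_set_closed : group_closed [in gen_set S].
Proof.
split=> [|x y]; rewrite ?unfold_in /=; first by rewrite in_setE => K [[]].
rewrite !in_setE => xS yS K KP; have [[_ KM KV] _] := KP.
by apply: KM; [exact: xS | apply: KV; exact: yS].
Qed.

HB.instance Definition _ := [isSub for @gen_val G S].
HB.instance Definition _ := [Choice of gen_group S by <:].
HB.instance Definition _ :=
  SubChoice_isSubGroup.Build G _ (gen_group S) gen_set_closed.

End GenGroup.

Definition finitely_generated (G : groupType) : Prop :=
  exists s : seq G, gen_set [set` s] = [set: G].

(* The letter (x, false) stands for the generator x, (x, true) for x^-1. *)
Definition word (X : Type) : Type := seq (X * bool).

(* A relation u = v between words is encoded as the pair (u, v); [pres_eq R] *)
(* is equality in the group < X | R >. *)
Inductive pres_eq (X : Type) (R : set (word X * word X)) :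
    word X -> word X -> Prop :=
  | PresRel u v : R (u, v) -> pres_eq R u v
  | PresCancel x b : pres_eq R [:: (x, b); (x, ~~ b)] [::]
  | PresRefl u : pres_eq R u u
  | PresSym u v : pres_eq R u v -> pres_eq R v u
  | PresTrans u v w : pres_eq R u v -> pres_eq R v w -> pres_eq R u w
  | PresCat u u' v v' :
      pres_eq R u u' -> pres_eq R v v' -> pres_eq R (u ++ v) (u' ++ v').

Section Presented.
Variables (X : choiceType) (R : set (word X * word X)).

Definition pres_eqb (u v : word X) : bool := `[< pres_eq R u v >].

Lemma pres_eqb_refl : reflexive pres_eqb.
Proof. by move=> u; apply/asboolP/PresRefl. Qed.

Lemma pres_eqb_sym : symmetric pres_eqb.
Proof. by move=> u v; apply/asboolP/asboolP => /PresSym. Qed.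

Lemma pres_eqb_trans : transitive pres_eqb.
Proof. by move=> v u w /asboolP uv /asboolP vw; apply/asboolP/(PresTrans uv). Qed.

Definition pres_equiv : equiv_rel (word X) :=
  EquivRel pres_eqb pres_eqb_refl pres_eqb_sym pres_eqb_trans.

Definition presented : Type := {eq_quot pres_equiv}.
HB.instance Definition _ := Choice.on presented.
HB.instance Definition _ := EqQuotient.on presented.

Definition pres_class (u : word X) : presented := \pi_presented u.

Lemma pres_classP (u v : word X) : pres_class u = pres_class v <-> pres_eq R u v.
Proof. by split=> [/eqmodP/asboolP //|uv]; apply/eqmodP/asboolP. Qed.

Lemma pres_class_repr (x : presented) : pres_class (repr x) = x.
Proof. exact: reprK. Qed.

Lemma repr_pres_class (u : word X) : pres_eq R (repr (pres_class u)) u.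
Proof. by apply/pres_classP; rewrite pres_class_repr. Qed.

Definition word_inv (u : word X) : word X := rev [seq (l.1, ~~ l.2) | l <- u].

Definition presM (x y : presented) : presented := pres_class (repr x ++ repr y).
Definition presV (x : presented) : presented := pres_class (word_inv (repr x)).
Definition pres1 : presented := pres_class [::].

Lemma pres_class_cat (u v : word X) :
  pres_class (u ++ v) = presM (pres_class u) (pres_class v).
Proof.
by apply/pres_classP; apply: PresCat; apply/PresSym/repr_pres_class.
Qed.

Lemma pres_eq_invl (u : word X) : pres_eq R (word_inv u ++ u) [::].
Proof.
elim: u => [|[x b] u IHu]; first exact: PresRefl.
rewrite /word_inv /= rev_cons cat_rcons; apply: PresTrans IHu.
apply: PresCat; first exact: PresRefl.
have cancel_xb := PresCancel R x (~~ b); rewrite negbK in cancel_xb.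
exact: PresCat cancel_xb (PresRefl R u).
Qed.

Lemma pres_eq_invr (u : word X) : pres_eq R (u ++ word_inv u) [::].
Proof.
have -> : u ++ word_inv u = word_inv (word_inv u) ++ word_inv u; last first.
  exact: pres_eq_invl.
congr (_ ++ _); rewrite /word_inv map_rev revK -map_comp.
by rewrite -[LHS]map_id; apply: eq_map => -[x b] /=; rewrite negbK.
Qed.

Lemma presMA : associative presM.
Proof.
move=> x y z.
rewrite -[x]pres_class_repr -[y]pres_class_repr -[z]pres_class_repr.
by rewrite -!pres_class_cat catA.
Qed.

Lemma pres1M : left_id pres1 presM.
Proof. by move=> x; rewrite -[x]pres_class_repr -pres_class_cat. Qed.

Lemma presM1 : right_id pres1 presM.
Proof. by move=> x; rewrite -[x]pres_class_repr -pres_class_cat cats0. Qed.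

Lemma presVM : left_inverse pres1 presV presM.
Proof.
move=> x; rewrite -[x in presM _ x]pres_class_repr -pres_class_cat.
exact/pres_classP/pres_eq_invl.
Qed.

Lemma presMV : right_inverse pres1 presV presM.
Proof.
move=> x; rewrite -[x in presM x _]pres_class_repr -pres_class_cat.
exact/pres_classP/pres_eq_invr.
Qed.

HB.instance Definition _ :=
  isGroup.Build presented presMA pres1M presM1 presVM presMV.

End Presented.

Definition finitely_presented (G : groupType) : Prop :=
  exists (n : nat) (R : seq (word 'I_n * word 'I_n)),
  exists f : {multiplicative presented [set` R] -> G}, bijective f.

(* [act g h] is g^h: a right action of H on G by group automorphisms. *)
Definition group_action (G H : groupType) (act : G -> H -> G) : Prop :=
  [/\ forall g, act g 1 = g,
      forall g h h1, act g (h * h1) = act (act g h) h1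
    & forall g g1 h, act (g * g1) h = act g h * act g1 h].

Definition compatible_actions (G H : groupType)
    (actG : G -> H -> G) (actH : H -> G -> H) : Prop :=
  (forall g g1 h, actG g (actH h g1) = (actG (g ^ g1^-1) h) ^ g1) /\
  (forall h h1 g, actH h (actG g h1) = (actH (h ^ h1^-1) g) ^ h1).

Definition derivative (G H : groupType) (act : G -> H -> G) : groupType :=
  gen_group [set x | exists g h, x = g^-1 * act g h].

Definition tensor_symbol (G H : groupType) (g : G) (h : H) : word (G * H) :=
  [:: ((g, h), false)].

Variant tensor_relation (G H : groupType)
    (actG : G -> H -> G) (actH : H -> G -> H) :
    set (word (G * H) * word (G * H)) :=
  | TensorMl g g1 h : tensor_relation actG actH
      (tensor_symbol (g * g1) h,
       tensor_symbol (g ^ g1) (actH h g1) ++ tensor_symbol g1 h)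
  | TensorMr g h h1 : tensor_relation actG actH
      (tensor_symbol g (h * h1),
       tensor_symbol g h1 ++ tensor_symbol (actG g h1) (h ^ h1)).

Definition tensor_product (G H : groupType)
    (actG : G -> H -> G) (actH : H -> G -> H) : groupType :=
  presented (tensor_relation actG actH).

(* Main.v *)
Require Import Defs.
From HB Require Import structures.
From mathcomp Require Import all_boot.
From mathcomp Require Import boolp classical_sets.

(**
  The map g (x) h |-> g^-1 g^h extends to a homomorphism [boundary] from the
  tensor product T onto the derivative [G, H], and conjugation by t in T acts on
  the symbols as conjugation by boundary t in G; so its kernel A is central.

  T is finitely generated: let t_i be lifts of generators of [G, H], and B the
  subgroup generated by the t_i, the boundary t_i (x) y and the x (x) y, for
  generators x of G and y of H. As T = <t_i> A, B is normal; the identities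
    st (x) h  = (s (x) h)^t (t (x) h)   for s, t read through the boundary,
    g (x) h k = (g (x) k) (g (x) h) (boundary (g (x) h) (x) k),
    v u (x) k = (u (x) k^v) (v (x) k)
  then show in turn that B contains every boundary t (x) h, every x (x) h and
  every g (x) h.

  A finitely generated central extension T of a finitely presented group by A is
  finitely presented: lifting generators and relators of the quotient shows that
  A is generated by finitely many elements c_1, ..., c_k, and one removes the c_j
  from the quotient one at a time. In each step the new generator c is central,
  each old relator becomes a power of c, and one relator c^d = 1 suffices.
*)

Set Implicit Arguments.
Unset Strict Implicit.
Unset Printing Implicit Defensive.

Local Open Scope classical_set_scope.
Local Open Scope group_scope.

(** * Generated subgroups and values of words *)

Definition group_norm (G : groupType) :=
  (@conjgE G, @invgM G, @invgK G, @invg1 G, @mulgA G,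
   @mulgK G, @mulgVK G, @mulVg G, @mulgV G, @mul1g G, @mulg1 G).

Lemma gen_set_subgroup (G : groupType) (S : set G) : subgroup_set (gen_set S).
Proof.
split=> [K [[]] //|x y Sx Sy K KP|x Sx K KP]; have [[_ KM KV] _] := KP.
  by apply: KM; [exact: Sx | exact: Sy].
by apply: KV; exact: Sx.
Qed.

Lemma sub_gen_set (G : groupType) (S : set G) : S `<=` gen_set S.
Proof. by move=> x Sx K [_]; apply. Qed.

Lemma gen_set_min (G : groupType) (S K : set G) :
  subgroup_set K -> S `<=` K -> gen_set S `<=` K.
Proof. by move=> KP SK x; apply. Qed.

Section Evaluation.
Variables (X : choiceType) (G : groupType).

Definition letter_val (e : X -> G) (l : X * bool) : G :=
  if l.2 then (e l.1)^-1 else e l.1.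

Definition word_val (e : X -> G) (u : word X) : G :=
  \prod_(l <- u) letter_val e l.

Lemma word_val_nil e : word_val e [::] = 1.
Proof. exact: big_nil. Qed.

Lemma word_val_cons e l u : word_val e (l :: u) = letter_val e l * word_val e u.
Proof. exact: big_cons. Qed.

Lemma word_val_cat e u v : word_val e (u ++ v) = word_val e u * word_val e v.
Proof. exact: big_cat. Qed.

Lemma word_val_seq1 e x : word_val e [:: (x, false)] = e x.
Proof. exact: big_seq1. Qed.

Lemma word_val_inv e u : word_val e (word_inv u) = (word_val e u)^-1.
Proof.
elim: u => [|[x b] u IHu]; first by rewrite word_val_nil invg1.
rewrite [in RHS]word_val_cons invgM -IHu /word_inv /= rev_cons -cats1 word_val_cat.
by congr (_ * _); rewrite /word_val big_seq1 /letter_val; case: b; rewrite ?invgK.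
Qed.

Lemma word_val_nseq e x k : word_val e (nseq k (x, false)) = e x ^+ k.
Proof.
by elim: k => [|k IHk]; rewrite ?word_val_nil // word_val_cons IHk expgS.
Qed.

End Evaluation.

Lemma word_val_map (X Y : choiceType) (G : groupType) (f : Y -> X) (e : X -> G) u :
  word_val e [seq (f l.1, l.2) | l <- u] = word_val (e \o f) u.
Proof. exact: big_map. Qed.

Lemma eq_word_val (X : choiceType) (G : groupType) (e e' : X -> G) :
  e =1 e' -> word_val e =1 word_val e'.
Proof. by move=> ee' u; apply: eq_bigr => l _; rewrite /letter_val ee'. Qed.

(** * Congruence modulo a central subgroup *)

Section Central.
Variable G : groupType.
Implicit Types (x y : G) (N : set G).

Definition central_subgroup N : Prop :=
  subgroup_set N /\ forall x y, N x -> commute x y.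

(** Equality in the quotient by [N], stated in [G] so that no quotient group has to be built. *)
Definition eqmod N x y : Prop := N (x^-1 * y).

Lemma central_subgroup1 : central_subgroup [set 1].
Proof.
split; first by split=> [//|x y -> ->|x ->]; rewrite ?mulg1 ?invg1.
by move=> x y ->; rewrite /commute mulg1 mul1g.
Qed.

Lemma eqmod1P x y : eqmod [set 1] x y <-> x = y.
Proof.
rewrite /eqmod; split=> [/= xy|->]; last exact: mulVg.
by rewrite -[x]mulg1 -xy mulVKg.
Qed.

Lemma eqmod_sub N N' x y : N `<=` N' -> eqmod N x y -> eqmod N' x y.
Proof. by move=> NN'; apply: NN'. Qed.

Lemma eqmodMl N z x y : eqmod N (z * x) (z * y) <-> eqmod N x y.
Proof. by rewrite /eqmod invgM -mulgA mulKg. Qed.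

Lemma eqmod_1l N x : eqmod N 1 x <-> N x.
Proof. by rewrite /eqmod invg1 mul1g. Qed.

Variables (N : set G) (NP : central_subgroup N).

Lemma eqmod_refl x : eqmod N x x.
Proof. by rewrite /eqmod mulVg; case: NP => [[]]. Qed.

Lemma eqmod_sym x y : eqmod N x y -> eqmod N y x.
Proof.
rewrite /eqmod => xy; have [[_ _ NV] _] := NP.
by rewrite -[y^-1 * x]invgK invgM invgK; apply: NV.
Qed.

Lemma eqmod_trans y x z : eqmod N x y -> eqmod N y z -> eqmod N x z.
Proof.
rewrite /eqmod => xy yz; have [[_ NM _] _] := NP.
by move: (NM _ _ xy yz); rewrite !group_norm.
Qed.

Lemma eqmodM x x' y y' : eqmod N x x' -> eqmod N y y' -> eqmod N (x * y) (x' * y').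
Proof.
rewrite /eqmod => xx yy; have [[_ NM _] NC] := NP.
have -> : (x * y)^-1 * (x' * y') = (x^-1 * x') * (y^-1 * y').
  by rewrite [RHS]mulgA (NC _ y^-1 xx) !group_norm.
exact: NM.
Qed.

Lemma eqmodMr z x y : eqmod N (x * z) (y * z) <-> eqmod N x y.
Proof.
split=> [xy|xy]; last exact/eqmodM/eqmod_refl.
by have := eqmodM xy (eqmod_refl z^-1); rewrite !mulgK.
Qed.

Lemma eqmod_1r x : eqmod N x 1 <-> N x.
Proof.
by split=> [/eqmod_sym|Nx]; [rewrite eqmod_1l | apply/eqmod_sym/eqmod_1l].
Qed.

(** Von Dyck's theorem with values in the quotient by [N]: as [N] is central, congruence respects
    products, so it inherits every consequence of the relations. *)
Lemma pres_eq_eqmod (X : choiceType) (R : set (word X * word X)) (e : X -> G) u v :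
  (forall u v, R (u, v) -> eqmod N (word_val e u) (word_val e v)) ->
  pres_eq R u v -> eqmod N (word_val e u) (word_val e v).
Proof.
move=> RN; elim=> {u v} [u v /RN //|x b|u|u v _ uv|u v w _ uv _ vw|].
- rewrite !word_val_cons word_val_nil mulg1 /letter_val /=.
  by case: b; rewrite /= ?mulVg ?mulgV; apply: eqmod_refl.
- exact: eqmod_refl.
- exact: eqmod_sym.
- exact: eqmod_trans vw.
- by move=> u u' v v' _ uu _ vv; rewrite !word_val_cat; apply: eqmodM.
Qed.

(* For central [c], the subgroup generated by [N] and [c]. *)
Definition central_ext N c : set G :=
  [set x | exists m n, eqmod N (c ^+ m) (x * c ^+ n)].

Lemma sub_central_ext c : N `<=` central_ext N c.
Proof. by move=> x Nx; exists 0, 0; rewrite /= mulg1; apply/eqmod_1l. Qed.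

Lemma mem_central_ext c : central_ext N c c.
Proof. by exists 1%N, 0; rewrite mulg1; apply: eqmod_refl. Qed.

Lemma central_extP c : (forall y, commute c y) -> central_subgroup (central_ext N c).
Proof.
move=> cC; have cXC k y : commute (c ^+ k) y.
  exact/commute_sym/commuteX/commute_sym.
split; first split.
- exact/sub_central_ext/(eqmod_1l _ _).1/eqmod_refl.
- move=> x y [m [n xP]] [m' [n' yP]]; exists (m + m')%N, (n + n')%N.
  have := eqmodM xP yP; rewrite !expgnDr.
  by rewrite -[x * _ * _]mulgA [c ^+ n * _]mulgA (cXC n y) !mulgA.
(* The two natural exponents stand for one integer, so inversion swaps them. *)
- move=> x [m [n xP]]; exists n, m; apply/eqmod_sym/(eqmodMl _ x).
  by rewrite mulVKg.
- move=> x y [m [n xP]].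
  have -> : x = (c ^+ m * ((c ^+ m)^-1 * (x * c ^+ n))) * (c ^+ n)^-1.
    by rewrite mulVKg mulgK.
  have [_ NC] := NP; apply: commute_sym; apply: commuteM; first apply: commuteM.
  + exact/commute_sym.
  + exact/commute_sym/NC.
  + exact/commuteV/commute_sym.
Qed.

(* The exponent [d] is 0 when no positive power of [c] lies in [N]. *)
Lemma central_exponent c : exists d, N (c ^+ d) /\
  forall m n, eqmod N (c ^+ m) (c ^+ n) -> m = n %[mod d].
Proof.
have [[N1 NM NV] _] := NP.
suff [d [Nd dP]] : exists d, N (c ^+ d) /\ forall k, N (c ^+ k) -> d %| k.
  exists d; split=> // m n; wlog mn : m n / m <= n => [W|] mnN.
    by case/orP: (leq_total m n) => /W; [|move=> /(_ (eqmod_sym mnN))/esym]; apply.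
  apply/eqP; rewrite eq_sym eqn_mod_dvd //; apply: dP.
  by move: mnN; rewrite /eqmod -{1}(subnKC mn) expgnDr mulKg.
have [[d0 [d0_gt0 Nd0]]|no_d] := pselect (exists d, 0 < d /\ N (c ^+ d)).
  have exd : exists d, (0 < d) && `[< N (c ^+ d) >].
    by exists d0; rewrite d0_gt0; apply/asboolP.
  have [d /andP[d_gt0 /asboolP Nd] dmin] := ex_minnP exd.
  exists d; split=> // k Nk; rewrite /dvdn; apply: contraT; rewrite -lt0n => r_gt0.
  (* Division with remainder: a nonzero [k %% d] would be a positive exponent below the minimal
     [d]. *)
  have NX q : N (c ^+ d ^+ q) by elim: q => // q IHq; rewrite expgS; apply: NM.
  have Nr : N (c ^+ (k %% d)).
    rewrite -[c ^+ _](mulKg (c ^+ d ^+ (k %/ d))) -expgnA -expgnDr mulnC -divn_eq.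
    by rewrite mulnC expgnA; apply: NM Nk; apply: NV.
  have := dmin (k %% d); rewrite r_gt0 leqNgt ltn_pmod //.
  by move=> /(_ (introT andP (conj isT (asboolT Nr)))).
exists 0; split=> // k Nk; rewrite dvd0n -leqn0 leqNgt.
by apply/negP => k_gt0; apply: no_d; exists k.
Qed.

End Central.

(** * Homomorphisms from presented groups, and presentations of quotients *)

Section PresentedGroup.
Variables (X : choiceType) (R : set (word X * word X)).

Lemma pres_classM (u v : word X) :
  pres_class R (u ++ v) = pres_class R u * pres_class R v.
Proof. exact: pres_class_cat. Qed.

Lemma pres_class_word (u : word X) :
  pres_class R u = word_val (fun x => pres_class R [:: (x, false)]) u.
Proof.
elim: u => [|[x b] u IHu]; first by rewrite word_val_nil.
rewrite word_val_cons -IHu -cat1s pres_classM; congr (_ * _).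
case: b => //=; rewrite /letter_val /=.
apply/esym/mulg1_eq; rewrite -pres_classM.
exact/pres_classP/(@PresCancel _ _ x false).
Qed.

Variables (G : groupType) (e : X -> G).
Hypothesis eR : forall u v, R (u, v) -> word_val e u = word_val e v.

(** The homomorphism extending [e]; [eR] makes its value independent of the representative
    [repr p]. *)
Definition pres_lift (p : presented R) : G := word_val e (repr p).

Lemma pres_eq_word_val u v : pres_eq R u v -> word_val e u = word_val e v.
Proof.
move=> uv; apply/eqmod1P; apply: (pres_eq_eqmod (central_subgroup1 G)) uv.
by move=> {}u {}v /eR ->; apply/eqmod1P.
Qed.

Lemma pres_lift_class u : pres_lift (pres_class R u) = word_val e u.
Proof. exact/pres_eq_word_val/repr_pres_class. Qed.

Lemma pres_liftM : {morph pres_lift : p q / p * q}.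
Proof.
move=> p q; rewrite -[p]pres_class_repr -[q]pres_class_repr -pres_classM.
by rewrite !pres_lift_class word_val_cat.
Qed.

End PresentedGroup.

(* [G / N] is finitely presented, without forming the quotient. *)
Definition fp_mod (G : groupType) (N : set G) : Prop :=
  exists n (R : seq (word 'I_n * word 'I_n)) (e : 'I_n -> G),
    (forall g, exists u, eqmod N (word_val e u) g) /\
    (forall u v, pres_eq [set` R] u v <-> eqmod N (word_val e u) (word_val e v)).

Lemma fp_mod1 (G : groupType) : fp_mod [set 1 : G] -> finitely_presented G.
Proof.
move=> [n [R [e [eG eR]]]]; exists n, R.
have eR' u v : [set` R] (u, v) -> word_val e u = word_val e v.
  by move=> uv; apply/eqmod1P/eR/PresRel.
pose fM := isMultiplicative.Build _ _ _ (pres_liftM eR').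
pose f : {multiplicative presented [set` R] -> G} := HB.pack (pres_lift e) fM.
have f_inj : injective f.
  move=> p q; rewrite -[p]pres_class_repr -[q]pres_class_repr /=.
  by rewrite !pres_lift_class // => pq; apply/pres_classP/eR/eqmod1P.
have /choice[h fK] : forall g, exists p, f p = g.
  move=> g; have [u /eqmod1P <-] := eG g.
  by exists (pres_class _ u); rewrite /= pres_lift_class.
by exists f, h => // p; apply: f_inj; rewrite fK.
Qed.

(** * Removing one central generator from the quotient *)

Section CentralExtension.
Variables (G : groupType) (N : set G) (c : G).
Hypotheses (NP : central_subgroup N) (cC : forall y, commute c y).

Lemma fp_mod_central_ext : fp_mod (central_ext N c) -> fp_mod N.
Proof.
move=> [n [R [e [eG eR]]]].
(* [ord0] is the new letter, with value [c]; [emb] shifts the old letters past it. *)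
pose e' (i : 'I_n.+1) := oapp e c (unlift ord0 i).
pose emb (u : word 'I_n) : word 'I_n.+1 := [seq (lift ord0 l.1, l.2) | l <- u].
pose cw k : word 'I_n.+1 := nseq k (ord0, false).
have valE (K : groupType) (k : 'I_n.+1 -> K) u :
    word_val k (emb u) = word_val (k \o lift ord0) u.
  exact: word_val_map.
have e'emb u : word_val e' (emb u) = word_val e u.
  by rewrite valE; apply: eq_word_val => i /=; rewrite /e' liftK.
have e'cw k : word_val e' (cw k) = c ^+ k.
  by rewrite word_val_nseq /e' unlift_none.
(* Modulo [N] the two sides of a relator in [R] differ by a power of [c]; [mn] chooses the
   correcting exponents, and [(0, 0)] fills in outside [R]. *)
have /choice[mn mnP] : forall r, exists mn : nat * nat, [set` R] r ->
    eqmod N (word_val e r.1 * c ^+ mn.1) (word_val e r.2 * c ^+ mn.2).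
  move=> [u v]; have [uv|] := pselect ([set` R] (u, v)); last by exists (0, 0).
  have [k [l kl]] := (eR u v).1 (PresRel uv).
  by exists (k, l) => _ /=; apply/(eqmodMl _ (word_val e u)^-1); rewrite mulKg mulgA.
have [d [Nd dP]] := central_exponent NP c.
pose comm_rel (i : 'I_n) : word 'I_n.+1 * word 'I_n.+1 :=
  ([:: (lift ord0 i, false); (ord0, false)], [:: (ord0, false); (lift ord0 i, false)]).
pose lift_rel r : word 'I_n.+1 * word 'I_n.+1 :=
  (emb r.1 ++ cw (mn r).1, emb r.2 ++ cw (mn r).2).
pose R' := (cw d, [::]) :: [seq comm_rel i | i : 'I_n] ++ [seq lift_rel r | r <- R].
have R'd : [set` R'] (cw d, [::]) by rewrite /= inE eqxx.
have R'C i : [set` R'] (comm_rel i).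
  by rewrite /= inE mem_cat map_f ?orbT // mem_enum.
have R'R r : r \in R -> [set` R'] (lift_rel r).
  by move=> rR; rewrite /= inE mem_cat [X in _ || (_ || X)]map_f ?orbT.
have e'R u v : [set` R'] (u, v) -> eqmod N (word_val e' u) (word_val e' v).
  rewrite /= inE mem_cat => /orP[/eqP[-> ->]|/orP[/mapP[i _ [-> ->]]|]].
  - by rewrite word_val_nil e'cw; apply/eqmod_1r.
  - rewrite !word_val_cons !word_val_nil /letter_val /= !mulg1 /e' unlift_none /=.
    by rewrite cC; apply: eqmod_refl.
  - move=> /mapP[r rR [-> ->]]; rewrite !word_val_cat !e'emb !e'cw.
    exact: mnP.
exists n.+1, R', e'; split=> [g|u v].
  have [u [k [l kl]]] := eG g.
  exists (emb u ++ cw k ++ word_inv (cw l)).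
  rewrite !word_val_cat word_val_inv e'emb !e'cw mulgA.
  apply/(eqmodMr NP (c ^+ l)); rewrite mulgVK.
  by apply/(eqmodMl _ (word_val e u)^-1); rewrite mulKg mulgA.
split=> [|uv]; first exact: pres_eq_eqmod.
(* For the converse one works in the group [P] of the new relators: there [tc] is central, and the
   old relators hold modulo the subgroup [C] it generates. *)
pose P := presented [set` R'].
pose te i : P := pres_class _ [:: (i, false)].
pose tc := te ord0.
have teE w : word_val te w = pres_class _ w by rewrite pres_class_word.
have tecw k : pres_class _ (cw k) = tc ^+ k :> P by rewrite -teE word_val_nseq.
have tcC : forall p, commute tc p.
  suff tcCw : forall w, commute tc (word_val te w).
    by move=> p; rewrite -[p]pres_class_repr -teE; apply: tcCw.
  elim=> [|[i b] w IHw]; first by rewrite word_val_nil; apply: commute1.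
  rewrite word_val_cons; apply: commuteM IHw; rewrite /letter_val /=.
  have tci : commute tc (te i).
    have [j ->|->] := unliftP ord0 i; last exact: commute_refl.
    by apply/esym; rewrite /commute -!pres_classM;
      apply/pres_classP/PresRel/R'C.
  by case: b => //=; apply: commuteV.
pose C := central_ext [set 1 : P] tc.
have CP : central_subgroup C := central_extP (central_subgroup1 P) tcC.
have Ctc : C tc by exact: mem_central_ext (central_subgroup1 P) tc.
have CtcX k : C (tc ^+ k).
  have [[C1 CM _] _] := CP.
  by elim: k => // k IHk; rewrite expgS; apply: CM.
have teR a b : [set` R] (a, b) ->
    eqmod C (word_val (te \o lift ord0) a) (word_val (te \o lift ord0) b).
  move=> /R'R/PresRel/pres_classP; rewrite -!teE !word_val_cat !valE !teE !tecw => ab.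
  apply/(eqmodMr CP (tc ^+ (mn (a, b)).1)); rewrite [X in eqmod _ X]ab.
  by apply/eqmodMl/(eqmod_trans CP (y := 1)); [apply/eqmod_1r|apply/eqmod_1l].
(* Deleting the occurrences of [ord0] changes a word only by an element of [C]. *)
have split_word w : exists w1, eqmod C (word_val (te \o lift ord0) w1) (pres_class _ w).
  elim: w => [|[i b] w [w1 IHw]].
    by exists [::]; rewrite word_val_nil; apply: eqmod_refl.
  have [j ->|->] := unliftP ord0 i.
    exists ((j, b) :: w1); rewrite -teE !word_val_cons /letter_val /= teE.
    exact: eqmodM (eqmod_refl _ _) IHw.
  exists w1; rewrite -teE word_val_cons -[word_val _ w1]mul1g teE.
  apply: eqmodM IHw => //; apply/eqmod_1l; rewrite /letter_val /=.
  by case: b => //=; have [[_ _ CV] _] := CP; apply: CV.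
suff kerP w : N (word_val e' w) -> pres_class [set` R'] w = 1.
  apply/pres_classP; have /kerP : N (word_val e' (word_inv u ++ v)).
    by rewrite word_val_cat word_val_inv.
  rewrite -!teE word_val_cat word_val_inv => /(congr1 ( *%g (word_val te u))).
  by rewrite mulVKg mulg1.
move=> Nw; have P_eq a b : pres_class [set` R'] a = pres_class [set` R'] b ->
    eqmod N (word_val e' a) (word_val e' b).
  by move=> /pres_classP; apply: pres_eq_eqmod.
have [w1 w1P] := split_word w.
(* The value of the old word [w1] lies in [central_ext N c], so by [eR] it is a consequence of [R],
   hence trivial modulo [C]; so is [w]. *)
have Cw : C (pres_class _ w).
  apply/(@eqmod_1l _ C).
  suff w1C : eqmod C (word_val (te \o lift ord0) [::]) (word_val (te \o lift ord0) w1).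
    by rewrite word_val_nil in w1C; exact: (eqmod_trans CP w1C w1P).
  apply: (pres_eq_eqmod CP teR).
  apply/eR; rewrite word_val_nil eqmod_1l.
  move: w1P => [k [l /eqmod1P]]; rewrite -!tecw -valE teE -mulgA.
  move=> /(congr1 ( *%g (pres_class _ (emb w1)))); rewrite mulVKg -!pres_classM.
  move=> /P_eq; rewrite !word_val_cat e'emb !e'cw => kl.
  exists l, k; apply: (eqmod_sym NP); apply: (eqmod_trans NP kl).
  rewrite -[X in eqmod _ _ X]mul1g; apply/eqmodMr => //; exact/eqmod_1r.
(* In [P], [w] is now a quotient of two powers of [tc]. Its value lies in [N], so the exponents
   agree modulo [d], and [tc ^+ d = 1] makes [w] trivial. *)
move: (Cw) => [k [l /eqmod1P]]; rewrite -!tecw -pres_classM => kl.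
have /P_eq := kl; rewrite word_val_cat !e'cw => klN.
have /dP kl_mod : eqmod N (c ^+ k) (c ^+ l).
  apply: (eqmod_trans NP klN); rewrite -[X in eqmod _ _ X]mul1g.
  by apply/eqmodMr => //; apply/eqmod_1r.
have tcd : tc ^+ d = 1 by rewrite -tecw; apply/pres_classP/PresRel.
have tc_mod m : tc ^+ m = tc ^+ (m %% d).
  by rewrite {1}(divn_eq m d) expgnDr mulnC expgnA tcd expg1n mul1g.
move: kl; rewrite pres_classM !tecw tc_mod kl_mod -tc_mod => kl.
by apply: (mulIg (tc ^+ l)); rewrite mul1g.
Qed.

End CentralExtension.

(** * Finite presentability of central extensions *)

Section CentralKernel.
Variable G : groupType.
Implicit Types (A K : set G) (s : seq G).

(** For central elements, the subgroup generated by [s], in the form from which [fp_mod_central_ext]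
    strips one generator at a time. *)
Definition central_span s : set G := foldr (fun c N => central_ext N c) [set 1] s.

Lemma central_spanP s :
  (forall c, c \in s -> forall y, commute c y) -> central_subgroup (central_span s).
Proof.
elim: s => [|c s IHs] sC; first exact: central_subgroup1.
apply: central_extP; last exact/sC/mem_head.
by apply: IHs => b bs; apply: sC; rewrite inE bs orbT.
Qed.

Lemma mem_central_span s c :
  (forall b, b \in s -> forall y, commute b y) -> c \in s -> central_span s c.
Proof.
elim: s => // b s IHs sC; have sC' a : a \in s -> forall y, commute a y.
  by move=> a_s; apply: sC; rewrite inE a_s orbT.
rewrite inE => /predU1P[->|cs]; first exact/mem_central_ext/central_spanP.
exact/sub_central_ext/IHs.
Qed.

Lemma central_span_min s K :
  subgroup_set K -> (forall c, c \in s -> K c) -> central_span s `<=` K.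
Proof.
move=> [K1 KM KV].
elim: s => [|c s IHs] sK x; first by move=> ->.
have Kc : K c by exact/sK/mem_head.
have KX k : K (c ^+ k) by elim: k => // k IHk; rewrite expgS; apply: KM.
move=> [m [n xP]].
have -> : x = c ^+ m * ((c ^+ m)^-1 * (x * c ^+ n)) * (c ^+ n)^-1.
  by rewrite mulVKg mulgK.
apply: (KM); last exact/KV/KX; apply: (KM) => //; apply: IHs xP => b bs.
by apply: sK; rewrite inE bs orbT.
Qed.

Lemma fp_mod_central_span s :
  (forall c, c \in s -> forall y, commute c y) ->
  fp_mod (central_span s) -> finitely_presented G.
Proof.
elim: s => [|c s IHs] sC; first exact: fp_mod1.
have sC' b : b \in s -> forall y, commute b y.
  by move=> bs; apply: sC; rewrite inE bs orbT.
move=> /fp_mod_central_ext fpG; apply: IHs => //.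
by apply: fpG; [exact: central_spanP | exact/sC/mem_head].
Qed.

(** Take for [s] the errors of approximating the generators by words, and the values of the
    relators. Modulo its span every element of [A] is a word; that word is trivial modulo [A], so a
    consequence of [R], so trivial modulo the span. *)
Lemma finitely_generated_kernel A :
  central_subgroup A -> finitely_generated G -> fp_mod A ->
  exists s, (forall c, c \in s -> A c) /\ A = central_span s.
Proof.
move=> AP [gens genG] [n [R [e [eG eR]]]].
have [w wP] := choice eG.
pose rel_val (r : word 'I_n * word 'I_n) := (word_val e r.1)^-1 * word_val e r.2.
pose gen_err g := (word_val e (w g))^-1 * g.
pose s := [seq gen_err g | g <- gens] ++ [seq rel_val r | r <- R].
have sA c : c \in s -> A c.
  rewrite mem_cat => /orP[/mapP[g _ ->]|]; first exact: wP.
  by move=> /mapP[[u v] uv ->]; apply/eR/PresRel.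
exists s; split=> //; have [AS Acomm] := AP.
have sC c : c \in s -> forall y, commute c y by move=> /sA /Acomm.
apply/seteqP; split; last exact: central_span_min.
set C := central_span s; have CP : central_subgroup C by exact: central_spanP.
have eC u v : pres_eq [set` R] u v -> eqmod C (word_val e u) (word_val e v).
  apply: pres_eq_eqmod => // a b ab; apply: mem_central_span => //.
  by rewrite mem_cat (map_f rel_val ab) orbT.
have G_C g : exists u, eqmod C (word_val e u) g.
  suff : gen_set [set` gens] `<=` [set x | exists u, eqmod C (word_val e u) x].
    by apply; rewrite genG.
  apply: gen_set_min => [|x xgens]; last first.
    by exists (w x); apply: mem_central_span => //; rewrite mem_cat (map_f gen_err xgens).
  split=> [|x y [u ux] [v vy]|x [u ux]].
  - by exists [::]; rewrite word_val_nil; apply: eqmod_refl.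
  - by exists (u ++ v); rewrite word_val_cat; apply: eqmodM.
  - exists (word_inv u); rewrite word_val_inv.
    apply/(eqmodMl _ (word_val e u)); rewrite mulgV.
    by apply/(eqmodMr CP x); rewrite mulgVK mul1g; apply: eqmod_sym.
move=> a Aa; have [u ua] := G_C a.
have CA : C `<=` A by exact: central_span_min.
have Au : eqmod A 1 (word_val e u).
  have /(eqmod_sub CA) ua' := ua.
  apply: (eqmod_trans AP _ (eqmod_sym AP ua')).
  by rewrite /eqmod invg1 mul1g.
have Cu : eqmod C 1 (word_val e u).
  by rewrite -(word_val_nil e); apply/eC/eR; rewrite word_val_nil.
by have := eqmod_trans CP Cu ua; rewrite /eqmod invg1 mul1g.
Qed.

Lemma central_extension_fp A :
  central_subgroup A -> finitely_generated G -> fp_mod A -> finitely_presented G.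
Proof.
move=> AP fgG fpA; have [s [sA As]] := finitely_generated_kernel AP fgG fpA.
apply: (@fp_mod_central_span s); last by rewrite -As.
by move=> c /sA Ac y; have [_ Acomm] := AP; apply: Acomm.
Qed.

End CentralKernel.

(** * Presenting the quotient by the kernel of a homomorphism *)

Section MorphismLaws.
Variables (G K : groupType) (f : G -> K).
Hypothesis fM : {morph f : x y / x * y}.

Lemma morphM_1 : f 1 = 1.
Proof. by apply: (mulgI (f 1)); rewrite -fM !mulg1. Qed.

Lemma morphM_inv x : f x^-1 = (f x)^-1.
Proof. by apply/esym/mulg1_eq; rewrite -fM mulgV morphM_1. Qed.

Lemma morphM_word_val (X : choiceType) (e : X -> G) u :
  f (word_val e u) = word_val (f \o e) u.
Proof.
elim: u => [|[x b] u IHu]; first by rewrite !word_val_nil morphM_1.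
rewrite !word_val_cons fM IHu; congr (_ * _).
by case: b => //=; rewrite /letter_val /= morphM_inv.
Qed.

End MorphismLaws.

(** First isomorphism theorem: the generators of the image are lifted through [lam], and a word is
    trivial in the image exactly when its lift lies in the kernel. *)
Lemma fp_mod_kernel (T G : groupType) (S : set G) (lam : T -> G) :
  {morph lam : x y / x * y} -> (forall g, gen_set S g <-> exists t, lam t = g) ->
  finitely_presented (gen_group S) -> fp_mod [set t | lam t = 1].
Proof.
move=> lamM lamS [n [R [f [h fK hK]]]].
pose c i : presented [set` R] := pres_class _ [:: (i, false)].
have /choice[e eP] i : exists t, lam t = gen_val (f (c i)).
  by apply/lamS; case: (f (c i)) => x /=; rewrite in_setE.
have lamE u : lam (word_val e u) = gen_val (f (pres_class _ u)).
  rewrite pres_class_word (morphM_word_val lamM).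
  have fvM : {morph (fun p => gen_val (f p)) : p q / p * q}.
    by move=> p q; rewrite gmulfM.
  by rewrite (morphM_word_val fvM); apply: eq_word_val => i /=; rewrite eP.
exists n, R, e; split=> [t|u v].
  have : gen_set S (lam t) by apply/lamS; exists t.
  rewrite -in_setE => St; exists (repr (h (GenGroup St))).
  by rewrite /eqmod /= lamM (morphM_inv lamM) lamE pres_class_repr hK mulVg.
rewrite /eqmod /= lamM (morphM_inv lamM) !lamE -pres_classP.
split=> [->|uv]; first exact: mulVg.
by apply: (can_inj fK); apply: val_inj; rewrite /= -[LHS]mulg1 -uv mulVKg.
Qed.

(** * The boundary map of the tensor product and its central kernel *)

Section TensorProduct.
Variables (G H : groupType) (actG : G -> H -> G) (actH : H -> G -> H).
Hypotheses (actGP : group_action actG) (actHP : group_action actH).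
Hypothesis actC : compatible_actions actG actH.

Notation tensor := (tensor_product actG actH).

Definition tens (g : G) (h : H) : tensor := pres_class _ (tensor_symbol g h).

Lemma tensMl g g1 h : tens (g * g1) h = tens (g ^ g1) (actH h g1) * tens g1 h.
Proof. by rewrite -[RHS]pres_classM; apply/pres_classP/PresRel/TensorMl. Qed.

Lemma tensMr g h h1 : tens g (h * h1) = tens g h1 * tens (actG g h1) (h ^ h1).
Proof. by rewrite -[RHS]pres_classM; apply/pres_classP/PresRel/TensorMr. Qed.

Lemma tensor_ind (K : set tensor) :
  subgroup_set K -> (forall g h, K (tens g h)) -> forall t, K t.
Proof.
move=> [K1 KM KV] Ktens t; rewrite -[t]pres_class_repr pres_class_word.
elim: (repr t) => [|[[g h] b] u IHu]; first by rewrite word_val_nil.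
rewrite word_val_cons; apply: (KM) => //; have Kgh := Ktens g h.
by case: b => //; apply: KV.
Qed.

(** Compatibility read as equivariance of the action on [G] under [g1]. *)
Lemma act_conjG g g1 h : actG (g ^ g1) (actH h g1) = actG g h ^ g1.
Proof. by have [-> _] := actC; rewrite conjgK. Qed.

Lemma actHJ h h1 g : actH (h ^ h1) g = actH h g ^ actH h1 g.
Proof.
have [_ _ HmulM] := actHP.
have actM : {morph actH^~ g : x y / x * y} by move=> x y; rewrite HmulM.
by rewrite !conjgE !HmulM (morphM_inv actM).
Qed.

Lemma actGVK g h : actG (actG g h^-1) h = g.
Proof. by have [G1 GM _] := actGP; rewrite -GM mulVg G1. Qed.

Lemma actHVK h g : actH (actH h g^-1) g = h.
Proof. by have [H1 HM _] := actHP; rewrite -HM mulVg H1. Qed.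

Lemma tens1 h : tens 1 h = 1.
Proof.
have [H1 _ _] := actHP; apply: (mulIg (tens 1 h)).
by have := tensMl 1 1 h; rewrite mulg1 conj1g H1 mul1g => <-.
Qed.

Lemma tensg1 g : tens g 1 = 1.
Proof.
have [G1 _ _] := actGP; apply: (mulgI (tens g 1)).
by have := tensMr g 1 1; rewrite mulg1 conj1g G1 mulg1 => <-.
Qed.

Definition displacement (gh : G * H) : G := gh.1^-1 * actG gh.1 gh.2.

Lemma displacement_rel u v :
  tensor_relation actG actH (u, v) -> word_val displacement u = word_val displacement v.
Proof.
have [_ GM GmulM] := actGP.
move=> uv; inversion_clear uv as [g g1 h|g h h1];
  rewrite !word_val_cons !word_val_nil /letter_val /displacement /= !mulg1.
  (* [TensorMl] is respected by compatibility, [TensorMr] by the identity [h * h1 = h1 * h ^ h1]. *)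
  by rewrite act_conjG GmulM !group_norm.
by rewrite -GM -conjgC GM !group_norm.
Qed.

Definition boundary : tensor -> G := pres_lift displacement.
Local Notation lam := boundary.

Lemma boundaryM : {morph lam : s t / s * t}.
Proof. exact: pres_liftM displacement_rel. Qed.

Lemma boundary_tens g h : lam (tens g h) = g^-1 * actG g h.
Proof. by rewrite /lam pres_lift_class ?word_val_seq1 //; apply: displacement_rel. Qed.

(* Expand [tens (p * g1) (q * h1)] in two ways, [p] and [q] being chosen so that *)
(* [tens g h] occurs in the first expansion. *)
Lemma tensJ_tens g h g1 h1 :
  tens g h ^ tens g1 h1 = tens (g ^ (g1^-1 * actG g1 h1)) (actH h (g1^-1 * actG g1 h1)).
Proof.
have [_ _ GmulM] := actGP; have [_ HM HmulM] := actHP.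
pose P := g ^ g1^-1; pose Q := actH h g1^-1.
pose p := actG P h1^-1; pose q := Q ^ h1^-1.
have pP : actG p h1 = P by rewrite /p actGVK.
have qQ : q ^ h1 = Q by rewrite /q conjgKV.
have El : tens (p * g1) (q * h1) = tens (p ^ g1) (actH h1 g1) *
    tens (P ^ g1) (actH Q g1) * (tens g1 h1 * tens (actG g1 h1) Q).
  rewrite (tensMl p g1 (q * h1)) HmulM (tensMr (p ^ g1) (actH q g1) (actH h1 g1)).
  by rewrite (tensMr g1 q h1) act_conjG -actHJ pP qQ.
have Er : tens (p * g1) (q * h1) = tens (p ^ g1) (actH h1 g1) * tens g1 h1 *
    (tens (P ^ actG g1 h1) (actH Q (actG g1 h1)) * tens (actG g1 h1) Q).
  rewrite (tensMr (p * g1) q h1) (tensMl p g1 h1) GmulM.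
  by rewrite (tensMl (actG p h1) (actG g1 h1) (q ^ h1)) pP qQ.
have : tens g h * tens g1 h1 =
    tens g1 h1 * tens (g ^ (g1^-1 * actG g1 h1)) (actH h (g1^-1 * actG g1 h1)).
  rewrite conjgM HM -/P -/Q.
  (* Both expansions share their first and last factors; cancelling these leaves the claim. *)
  apply: (mulgI (tens (p ^ g1) (actH h1 g1))); apply: (mulIg (tens (actG g1 h1) Q)).
  by move: El; rewrite Er !mulgA => ->; rewrite /P /Q conjgKV actHVK.
by move=> E; apply: (mulgI (tens g1 h1)); rewrite -conjgC.
Qed.

Lemma tensJ t g h : tens g h ^ t = tens (g ^ lam t) (actH h (lam t)).
Proof.
have [H1 HM _] := actHP.
pose K : set tensor :=
  [set t | forall g h, tens g h ^ t = tens (g ^ lam t) (actH h (lam t))].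
apply: (@tensor_ind K); last by move=> g1 h1 x y; rewrite tensJ_tens boundary_tens.
split=> [x y|s r Ks Kr x y|s Ks x y] /=.
- by rewrite (morphM_1 boundaryM) !conjg1 H1.
- by rewrite boundaryM !conjgM Ks Kr HM.
- by apply: (@conjg_inj _ s); rewrite conjgKV Ks (morphM_inv boundaryM) conjgKV actHVK.
Qed.

Lemma boundary_ker_central : central_subgroup [set t | lam t = 1].
Proof.
split; first split=> [|s t /= s1 t1|s /= s1].
- exact: morphM_1 boundaryM.
- by rewrite boundaryM s1 t1 mulg1.
- by rewrite (morphM_inv boundaryM) s1 invg1.
move=> s t /= s1; apply: (@tensor_ind (commute s)).
  split=> [|x y|x]; [exact: commute1 | exact: commuteM | exact: commuteV].
move=> g h; apply/commute_sym; rewrite /commute conjgC tensJ s1.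
by have [H1 _ _] := actHP; rewrite conjg1 H1.
Qed.

Lemma boundary_image g :
  gen_set [set x | exists g h, x = g^-1 * actG g h] g <-> exists t, lam t = g.
Proof.
split=> [|[t <-]].
  move: g; apply: gen_set_min => [|_ [g [h ->]]]; last first.
    by exists (tens g h); rewrite boundary_tens.
  split=> [|_ _ [s <-] [t <-]|_ [s <-]].
  - by exists 1; apply: morphM_1 boundaryM.
  - by exists (s * t); rewrite boundaryM.
  - by exists s^-1; rewrite (morphM_inv boundaryM).
set S := (X in gen_set X); have [S1 SM SV] := gen_set_subgroup S.
apply: (@tensor_ind [set r | gen_set S (lam r)]) => [|g1 h1].
  split=> [|r s Sr Ss|s Ss] /=.
  - by rewrite (morphM_1 boundaryM).
  - by rewrite boundaryM; apply: SM.
  - by rewrite (morphM_inv boundaryM); apply: SV.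
by apply: sub_gen_set; exists g1, h1; rewrite boundary_tens.
Qed.

(* [tensMr] without the action of [h] on the second factor: expand the product *)
(* [h1 ^ h^-1 * h] instead. *)
Lemma tensMr_boundary g h h1 :
  tens g (h * h1) = tens g h1 * tens g h * tens (lam (tens g h)) h1.
Proof.
have -> : h * h1 = h1 ^ h^-1 * h by rewrite !group_norm.
have -> : tens g (h1 ^ h^-1 * h) = tens g h * tens (actG g h) h1.
  by rewrite tensMr conjgKV.
have {1}-> : actG g h = g * lam (tens g h) by rewrite boundary_tens mulVKg.
by rewrite tensMl -tensJ !group_norm.
Qed.

Lemma tensMl_act v u k : tens (v * u) k = tens u (actH k v) * tens v k.
Proof. by rewrite conjgCV tensMl conjgKV. Qed.

(** * Finite generation of the tensor product *)

Lemma tensor_finitely_generated :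
  finitely_generated G -> finitely_generated H ->
  fp_mod [set t | lam t = 1] -> finitely_generated tensor.
Proof.
move=> [X genX] [Y genY] [n [_ [e [eT _]]]].
have [_ HM _] := actHP.
pose s := [seq e i | i : 'I_n] ++
  ([seq tens (lam (e i)) y | i <- enum 'I_n, y <- Y] ++ [seq tens x y | x <- X, y <- Y]).
exists s; set B := gen_set _; have BP : subgroup_set B := gen_set_subgroup _.
have [B1 BM BV] := BP.
have sB t : t \in s -> B t by move=> ts; apply: sub_gen_set.
have Be i : B (e i) by apply: sB; rewrite mem_cat map_f ?mem_enum.
have Bey i y : y \in Y -> B (tens (lam (e i)) y).
  move=> yY; apply: sB; rewrite !mem_cat; apply/orP; right; apply/orP; left.
  by apply: (allpairs_f (fun i y => tens (lam (e i)) y)); rewrite ?mem_enum.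
have Bxy x y : x \in X -> y \in Y -> B (tens x y).
  move=> xX yY; apply: sB; rewrite !mem_cat; apply/orP; right; apply/orP; right.
  exact: allpairs_f.
have Bword u : B (word_val e u).
  elim: u => [|[i b] u IHu]; first by rewrite word_val_nil.
  rewrite word_val_cons; apply: (BM) => //; rewrite /letter_val /=.
  by case: b; [exact: BV | exact: Be].
have Tdec t : exists u a, lam a = 1 /\ t = word_val e u * a.
  by have [u ua] := eT t; exists u, ((word_val e u)^-1 * t); rewrite mulVKg.
(* [B] is normal: [t] is a word in the [e i], which lies in [B], times a central element of the
   kernel. *)
have BJ b t : B b -> B (b ^ t).
  move=> Bb; have [u [a [a1 ->]]] := Tdec t; rewrite conjgM.
  have [_ ker_comm] := boundary_ker_central.
  rewrite [_ ^ a]conjgE -(ker_comm a (b ^ word_val e u) a1) mulKg.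
  by apply: (BM); [apply: (BV); exact: Bword | apply: (BM) => //; exact: Bword].
have K_all (K : set tensor) : subgroup_set K -> (forall a, lam a = 1 -> K a) ->
    (forall i, K (e i)) -> forall t, K t.
  move=> [K1 KM KV] Kker Ke t; have [u [a [/Kker Ka ->]]] := Tdec t.
  apply: (KM) => //; elim: u => [|[i b] u IHu]; first by rewrite word_val_nil.
  rewrite word_val_cons; apply: (KM) => //; rewrite /letter_val /=.
  by case: b; [exact: KV | exact: Ke].
(* As [B] is normal, this identity makes the [t] with [B (tens (lam t) h)] a subgroup. *)
have BlamM h r t : B (tens (lam (r * t)) h) <-> B (tens (lam r) h ^ t * tens (lam t) h).
  by rewrite boundaryM tensMl -tensJ.
have Bcancel x y : B y -> B (x * y) -> B x.
  by move=> By Bxy'; rewrite -(mulgK y x); apply: (BM) => //; apply: BV.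
have Blam_y y t : y \in Y -> B (tens (lam t) y).
  move=> yY; apply: (K_all [set t | B (tens (lam t) y)]).
  - split=> [|a b /= Ba Bb|a /= Ba] /=.
    + by rewrite (morphM_1 boundaryM) tens1.
    + by apply/BlamM; apply: (BM) => //; exact: BJ.
    + rewrite -[tens _ _](conjgK a); apply: BJ; apply: (Bcancel _ _ Ba).
      by apply/BlamM; rewrite mulVg (morphM_1 boundaryM) tens1.
  - by move=> a /= ->; rewrite tens1.
  - by move=> i; apply: Bey.
have Blam h t : B (tens (lam t) h).
  (* All [t] are treated at once, since the last factor in [tensMr_boundary] involves the boundary
     of another tensor. *)
  move: t; suff: gen_set [set` Y] `<=` [set h | forall t, B (tens (lam t) h)].
    by apply; rewrite genY.
  apply: gen_set_min => [|y yY t]; last exact: Blam_y.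
  split=> [t|a b Ba Bb t|a Ba t].
  - by rewrite tensg1.
  - by rewrite tensMr_boundary; apply: (BM); [exact: BM | exact: Bb].
  (* Expanding [tens (lam t) (a^-1 * a) = 1] by [tensMr_boundary] gives a product whose first and
     last factors lie in [B], hence also the middle one. *)
  - rewrite -[tens _ _](mulKg (tens (lam t) a)).
    apply: (BM); first by apply: (BV); exact: Ba.
    apply: Bcancel (Ba (tens (lam t) a^-1)) _.
    by rewrite -tensMr_boundary mulVg tensg1.
have Bx x h : x \in X -> B (tens x h).
  move=> xX; suff: gen_set [set` Y] `<=` [set h | B (tens x h)].
    by apply; rewrite genY.
  apply: gen_set_min => [|y yY]; last exact: Bxy.
  split=> [|a b Ba Bb|a Ba] /=.
  - by rewrite tensg1.
  - by rewrite tensMr_boundary; apply: (BM) => //; apply: (BM).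
  - rewrite -[tens _ _](mulKg (tens x a)).
    apply: (BM); first exact: BV.
    apply: Bcancel (Blam a (tens x a^-1)) _.
    by rewrite -tensMr_boundary mulVg tensg1.
have Bg g h : B (tens g h).
  (* All [h] are treated at once, since [tensMl_act] changes the second argument. *)
  move: h; suff: gen_set [set` X] `<=` [set g | forall h, B (tens g h)].
    by apply; rewrite genX.
  apply: gen_set_min => [|x xX h]; last exact: Bx.
  split=> [h|a b Ba Bb h|a Ba h] /=.
  - by rewrite tens1.
  - by rewrite tensMl_act; apply: (BM); [exact: Bb | exact: Ba].
  (* Writing [h] as the image under [a] of [actH h a^-1] makes [tens a^-1 h] a factor of the
     expansion of [tens (a * a^-1) _ = 1]. *)
  - rewrite -(actHVK h a); apply: Bcancel (Ba (actH h a^-1)) _.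
    by rewrite -tensMl_act mulgV tens1.
by apply/seteqP; split=> // t _; apply: tensor_ind.
Qed.

End TensorProduct.

Theorem theorem1p3 (G H : groupType)
    (actG : G -> H -> G) (actH : H -> G -> H)
    (actGP : group_action actG) (actHP : group_action actH)
    (actC : compatible_actions actG actH)
    (fgG : finitely_generated G) (fgH : finitely_generated H)
    (fpD : finitely_presented (derivative actG)) :
  finitely_presented (tensor_product actG actH).
Proof.
have fp_ker : fp_mod [set t | boundary (actG := actG) (actH := actH) t = 1].
  exact: (fp_mod_kernel (boundaryM actGP actC) (boundary_image actGP actC) fpD).
apply: (central_extension_fp _ _ fp_ker); first exact: boundary_ker_central.
exact: (tensor_finitely_generated actGP actHP actC fgG fgH fp_ker).
Qed.
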